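(* The existence problems for bipolar ABA frameworks under admissible and under preferred semantics are constant with answer `yes': every bipolar ABA framework $\mathcal{F}=(\mathcal{L},\mathcal{R},\mathcal{A},\overline{\phantom{a}})$ admits an admissible extension and admits a preferred extension.
   Context: An ABA framework is a tuple $(\mathcal{L},\mathcal{R},\mathcal{A},\overline{\phantom{a}})$ where $\mathcal{L}$ is a set of sentences; $\mathcal{R}$ is a set of rules $\varphi_0\leftarrow\varphi_1,\dots,\varphi_m$ with $m\ge 0$ and all $\varphi_i\in\mathcal{L}$ (head $\varphi_0$, body $\varphi_1,\dots,\varphi_m$; for $m=0$ written $\varphi_0\leftarrow\top$ with $\top\notin\mathcal{L}$); $\mathcal{A}\subseteq\mathcal{L}$ is a non-empty set of assumptions; and $\overline{\phantom{a}}:\mathcal{A}\to\mathcal{L}$ is a total map ($\overline{\alpha}$ is the contrary of $\alpha$). It is bipolar iff every rule is of the form $\varphi\leftarrow\alpha$ with $\alpha\in\mathcal{A}$ and either $\varphi\in\mathcal{A}$ or $\varphi=\overline{\beta}$ for some $\beta\in\mathcal{A}$. A deduction $A\vdash^{R}\varphi$ for $\varphi\in\mathcal{L}$ supported by $A\subseteq\mathcal{A}$ and $R\subseteq\mathcal{R}$ is a finite tree with root labelled $\varphi$; leaves labelled by $\top$ or assumptions, with $A$ the set of all assumptions labelling leaves; and the children of each non-leaf labelled $\psi$ labelled by the elements of the body of some rule in $\mathcal{R}$ with head $\psi$ (a single child $\top$ if the body is empty), with $R$ the set of all rules so used. For $A,B\subseteq\mathcal{A}$: $A$ attacks $B$ if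 there is a deduction $A'\vdash^{R}\overline{\beta}$ with $\beta\in B$, $A'\subseteq A$, $R\subseteq\mathcal{R}$. $Cl(A)=\{\alpha\in\mathcal{A}:\exists\, A'\vdash^{R}\alpha,\ A'\subseteq A,\ R\subseteq\mathcal{R}\}$; $A$ is closed iff $A=Cl(A)$; $A$ is conflict-free iff $A$ does not attack $A$; $A$ defends $\alpha\in\mathcal{A}$ iff $A$ attacks every closed $B\subseteq\mathcal{A}$ that attacks $\{\alpha\}$; $A$ defends $B$ iff it defends every $\beta\in B$. $A$ is admissible iff it is closed, conflict-free and defends itself; $A$ is preferred iff it is $\subseteq$-maximal among admissible sets. *)

(* Defs.v *)
From mathcomp Require Import all_boot.
From mathcomp Require Import boolp classical_sets.

Set Implicit Arguments.
Unset Strict Implicit.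
Unset Printing Implicit Defensive.

Local Open Scope classical_set_scope.

Record rule (L : Type) := Rule { rule_head : L; rule_body : seq L }.

(* The contrary is defined on assumptions only: its domain is the subtype
   [set_type assumptions]. *)
Record aba := ABA {
  sentence : Type;
  rules : set (rule sentence);
  assumptions : set sentence;
  assumptions_nonempty : assumptions !=set0;
  contrary : set_type assumptions -> sentence
}.

Arguments rules : clear implicits.
Arguments assumptions : clear implicits.

(* Sets of assumptions are sets over this subtype, so that the side condition
   that they are included in [assumptions F] is carried by the type. *)
Definition assumption (F : aba) : Type := set_type (assumptions F).

Definition sentence_of (F : aba) (a : assumption F) : sentence F := val a.

Definition bipolar (F : aba) : Prop :=
  forall r : rule (sentence F), rules F r ->
    exists a : assumption F,
      rule_body r = [:: sentence_of a] /\
      (assumptions F (rule_head r) \/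
       exists b : assumption F, rule_head r = contrary b).

Section Deductions.
Variable F : aba.

(* An inner node carries the rule applied there; its label is the head of that
   rule. This makes the set of rules used by a tree well determined. *)
Inductive tree : Type :=
  | TopLeaf
  | AssumptionLeaf of assumption F
  | Node of rule (sentence F) & seq tree.

(* [None] stands for the label top, which is not a sentence. *)
Definition label (t : tree) : option (sentence F) :=
  match t with
  | TopLeaf => None
  | AssumptionLeaf a => Some (sentence_of a)
  | Node r _ => Some (rule_head r)
  end.

Definition child_labels (r : rule (sentence F)) : seq (option (sentence F)) :=
  if rule_body r is [::] then [:: None] else map Some (rule_body r).

Fixpoint valid_tree (t : tree) : Prop :=
  match t with
  | Node r ts =>
      [/\ rules F r, map label ts = child_labels r &
          foldr (fun t' P => valid_tree t' /\ P) True ts]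
  | _ => True
  end.

Fixpoint support (t : tree) : set (assumption F) :=
  match t with
  | TopLeaf => set0
  | AssumptionLeaf a => [set a]
  | Node _ ts => foldr (fun t' A => support t' `|` A) set0 ts
  end.

Fixpoint rules_used (t : tree) : set (rule (sentence F)) :=
  match t with
  | Node r ts => r |` foldr (fun t' R => rules_used t' `|` R) set0 ts
  | _ => set0
  end.

Definition deduction (A : set (assumption F)) (R : set (rule (sentence F)))
    (phi : sentence F) : Prop :=
  exists t : tree,
    [/\ valid_tree t, label t = Some phi, support t = A & rules_used t = R].

End Deductions.

Section Semantics.
Variable F : aba.
Implicit Types (A B : set (assumption F)) (a : assumption F).

Definition attacks A B : Prop :=
  exists (b : assumption F) (A' : set (assumption F))
         (R : set (rule (sentence F))),
    [/\ B b, deduction A' R (contrary b), A' `<=` A & R `<=` rules F].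

Definition Cl A : set (assumption F) :=
  [set a | exists (A' : set (assumption F)) (R : set (rule (sentence F))),
     [/\ deduction A' R (sentence_of a), A' `<=` A & R `<=` rules F]].

Definition closed_set A : Prop := A = Cl A.

Definition conflict_free A : Prop := ~ attacks A A.

Definition defends A a : Prop :=
  forall B, closed_set B -> attacks B [set a] -> attacks A B.

Definition defends_set A B : Prop := forall b, B b -> defends A b.

Definition admissible A : Prop :=
  [/\ closed_set A, conflict_free A & defends_set A A].

Definition preferred A : Prop :=
  admissible A /\ forall B, admissible B -> A `<=` B -> B = A.

End Semantics.

(* Main.v *)
(** In a bipolar framework every rule has exactly one assumption in its body, so
    a deduction is a path and is supported by exactly one assumption. A
    deduction from a union of sets is therefore a deduction from one of them,
    so the union of a chain of admissible sets is admissible, and Zorn's lemma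
    gives a preferred set. The empty chain is included: the empty set is
    admissible because nothing is deducible from it. *)
Require Import Defs.
From mathcomp Require Import all_boot.
From mathcomp Require Import boolp classical_sets.

Set Implicit Arguments.
Unset Strict Implicit.
Unset Printing Implicit Defensive.

Local Open Scope classical_set_scope.

Section Bipolar.
Variable F : aba.
Hypothesis bipF : bipolar F.

Lemma support_bipolar (t : tree F) :
  valid_tree t -> label t <> None -> exists a, Defs.support t = [set a].
Proof.
(* Trees are nested through [seq], so the recursion is explicit: the default induction principle
   gives no hypothesis on the children. *)
move: t; fix IH 1 => -[|a|r ts] //=; first by exists a.
move=> [/bipF[a [bodyr _]]].
rewrite /child_labels bodyr /=; case: ts => [|t [|? ?]] //= [lt] [vt _] _.
have [|b ->] := IH t vt; first by rewrite lt.
by exists b; rewrite setU0.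
Qed.

Lemma deduction_bipolar (A : set (assumption F)) R phi :
  deduction A R phi -> exists a, A = [set a].
Proof. by move=> [t [vt lt <- _]]; apply: support_bipolar => //; rewrite lt. Qed.

Lemma deduction_bigcup (C : set (set (assumption F))) A R phi :
  deduction A R phi -> A `<=` \bigcup_(X in C) X -> exists2 X, C X & A `<=` X.
Proof.
move=> /deduction_bipolar[a ->] /(_ a erefl)[X CX Xa].
by exists X => // _ ->.
Qed.

Lemma subset_Cl (A : set (assumption F)) : A `<=` Cl A.
Proof.
move=> a Aa; exists [set a], set0; split; [|by move=> _ ->|by []].
by exists (AssumptionLeaf a).
Qed.

Lemma attacks_sub (A A' B B' : set (assumption F)) :
  A `<=` A' -> B `<=` B' -> attacks A B -> attacks A' B'.
Proof.
move=> AA' BB' [b [S [R [Bb dS SA RF]]]].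
by exists b, S, R; split=> //; [exact: BB'|exact: subset_trans AA'].
Qed.

Lemma admissible_bigcup (C : set (set (assumption F))) :
  C `<=` @admissible F -> total_on C subset ->
  admissible (\bigcup_(X in C) X).
Proof.
move=> admC totC; split.
- apply/seteqP; split; first exact: subset_Cl.
  move=> a [S [R [dS SC RF]]]; have [X CX SX] := deduction_bigcup dS SC.
  (* The single member [X] containing the support is closed, so it already contains [a]. *)
  by exists X => //; have [-> _ _] := admC _ CX; exists S, R.
- move=> [b [S [R [[Y CY Yb] dS SC RF]]]].
  have [X CX SX] := deduction_bigcup dS SC.
  have attXY : attacks X Y by exists b, S, R.
  (* Of the attacking member [X] and the attacked member [Y], the larger one attacks itself. *)
  have [XY|YX] := totC _ _ CX CY.
  + by have [_ cfY _] := admC _ CY; apply/cfY/(attacks_sub XY _ attXY).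
  + by have [_ cfX _] := admC _ CX; apply/cfX/(attacks_sub _ YX attXY).
(* The member containing [b] defends it, and its counterattack is also one by the union. *)
- move=> b [X CX Xb] B clB attBb; have [_ _ defX] := admC _ CX.
  have := defX b Xb B clB attBb; apply: attacks_sub => //.
  exact: bigcup_sup.
Qed.

Lemma preferred_exists : exists A : set (assumption F), preferred A.
Proof.
have [A [admA maxA]] := Zorn_bigcup admissible_bigcup.
(* [maxA] rules out admissible proper supersets of [A], hence the argument by contradiction. *)
exists A; split=> // B admB AB; apply: contrapT => BA.
apply: (maxA B) => //; rewrite properEneq; split=> //.
by apply/eqP => /esym.
Qed.

End Bipolar.

Theorem proposition3p11 : forall F : aba, bipolar F ->
  (exists A : set (assumption F), admissible A) /\
  (exists A : set (assumption F), preferred A).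
Proof.
move=> F bipF; have [A prefA] := preferred_exists bipF.
by split; exists A => //; case: prefA.
Qed.
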